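(* Let $\tilde\Delta>0$ and, for $x\in\mathbb{R}^\kappa$ and $k\in\{1,2\}$, let $\Phi_k^{\tilde\Delta}(x)=\sup_{0\le t\le\tilde\Delta}(e^{At}x)^{k,1}$. Then for any $x\in\mathbb{R}^\kappa$, $$\Phi_k^{\tilde\Delta}(x)=\max_{0<t_c<\tilde\Delta}\left\{x^{k,1},\,(e^{At_c}x)^{k,1},\,(e^{A\tilde\Delta}x)^{k,1}\right\},$$ where the maximum is taken over the critical points $t_c\in(0,\tilde\Delta)$ of $t\mapsto(e^{At}x)^{k,1}$ (together with the two endpoint values), which are the solutions of the equation $$(-\nu_kx^{k,1}+x^{k,2})+\dots+(-\nu_kx^{k,\eta_k}+x^{k,\eta_k+1})\frac{t_c^{\eta_k-1}}{(\eta_k-1)!}+(-\nu_kx^{k,\eta_k+1})\frac{t_c^{\eta_k}}{\eta_k!}=0.$$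
   Context: Parameters: integers $\eta_1,\eta_2\ge1$, reals $\nu_1,\nu_2>0$, $\kappa=\eta_1+\eta_2+2$. A vector $x\in\mathbb{R}^\kappa$ is written $x=(x^1,x^2)$ with $x^k=(x^{k,1},\dots,x^{k,\eta_k+1})\in\mathbb{R}^{\eta_k+1}$. $A\in\mathbb{R}^{\kappa\times\kappa}$ is block-diagonal with blocks $A_{\nu_1},A_{\nu_2}$, where $A_{\nu_k}$ is the $(\eta_k+1)\times(\eta_k+1)$ matrix with $-\nu_k$ on the diagonal, $1$ on the first superdiagonal and $0$ elsewhere. The left-hand side of the critical-point equation is $\sum_{m=1}^{\eta_k}(-\nu_kx^{k,m}+x^{k,m+1})\frac{t_c^{m-1}}{(m-1)!}-\nu_kx^{k,\eta_k+1}\frac{t_c^{\eta_k}}{\eta_k!}$. *)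

(* Defs.v *)
From HB Require Import structures.
From mathcomp Require Import all_boot all_order all_algebra.
From mathcomp Require Import all_classical all_reals all_analysis.
Set Implicit Arguments.
Unset Strict Implicit.
Unset Printing Implicit Defensive.
Import Order.TTheory GRing.Theory Num.Theory.
Import numFieldNormedType.Exports.
Local Open Scope classical_set_scope.
Local Open Scope ring_scope.

Definition expmx (R : realType) (n : nat) (M : 'M[R]_n) : 'M[R]_n :=
  lim (series (fun j => (j`!%:R)^-1 *: M ^+ j) @ \oo).

Definition Ablock (R : realType) (n : nat) (a : R) : 'M[R]_n.+1 :=
  \matrix_(i, j) (if j == i then - a
                  else if val j == (val i).+1 then 1 else 0).

(* The two block labels are ['I_2], so that the state space has dimension
   [\sum_(i < 2) (eta i).+1 = eta_1 + eta_2 + 2]. *)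
Definition Amx (R : realType) (eta : 'I_2 -> nat) (nu : 'I_2 -> R) :
    'M[R]_(\sum_(i < 2) (eta i).+1) :=
  \mxdiag_(i < 2) Ablock (eta i) (nu i).

(* Coordinates inside a block are numbered from 0: [bcoord x k m] is
   x^{k,m+1}, for [m <= eta k]. *)
Definition bcoord (R : realType) (eta : 'I_2 -> nat)
    (x : 'cV[R]_(\sum_(i < 2) (eta i).+1)) (k : 'I_2) (m : nat) : R :=
  submxcol x k (inord m) ord0.

Definition traj (R : realType) (eta : 'I_2 -> nat) (nu : 'I_2 -> R)
    (x : 'cV[R]_(\sum_(i < 2) (eta i).+1)) (k : 'I_2) (t : R) : R :=
  bcoord (expmx (t *: Amx eta nu) *m x) k 0.

Definition traj_values (R : realType) (eta : 'I_2 -> nat) (nu : 'I_2 -> R)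
    (Delta : R) (k : 'I_2) (x : 'cV[R]_(\sum_(i < 2) (eta i).+1)) : set R :=
  [set traj nu x k t | t in [set t | 0 <= t <= Delta]].

Definition Phi (R : realType) (eta : 'I_2 -> nat) (nu : 'I_2 -> R)
    (Delta : R) (k : 'I_2) (x : 'cV[R]_(\sum_(i < 2) (eta i).+1)) : R :=
  sup (traj_values nu Delta k x).

(* [is_derive] is used rather than [f^`() t = 0], which would also hold at
   points where [f] is not derivable. *)
Definition critical_points (R : realType) (f : R -> R) (Delta : R) : set R :=
  [set t | 0 < t < Delta /\ is_derive t (1 : R) f 0].

Definition crit_lhs (R : realType) (eta : 'I_2 -> nat) (nu : 'I_2 -> R)
    (x : 'cV[R]_(\sum_(i < 2) (eta i).+1)) (k : 'I_2) (t : R) : R :=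
  \sum_(m < eta k)
    (- nu k * bcoord x k m + bcoord x k m.+1) * (t ^+ m / m`!%:R)
  - nu k * bcoord x k (eta k) * (t ^+ eta k / (eta k)`!%:R).

Definition is_max (R : realType) (S : set R) (v : R) : Prop :=
  S v /\ ubound S v.

(* Main.v *)
(** The matrix exponential acts block by block, and the [j]-th power of the block
    [Ablock n a] has the entries ['C(j, l - i) (-a)^(j - (l - i))] (Pascal's
    rule). Summing the exponential series of such an entry gives
    [traj nu x k t = e^{-nu_k t} \sum_m x^{k,m+1} t^m / m!], whose derivative is
    [e^{-nu_k t}] times the left-hand side of the critical-point equation. As the
    exponential does not vanish, the critical points are the solutions of that
    equation, and the continuous function [traj nu x k] attains its maximum on
    [0, Delta] at an endpoint or at one of them. *)
Require Import Defs.
From HB Require Import structures.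
From mathcomp Require Import all_boot all_order all_algebra.
From mathcomp Require Import all_classical all_reals all_analysis.
From mathcomp Require Import ring.
Set Implicit Arguments.
Unset Strict Implicit.
Unset Printing Implicit Defensive.
Import Order.TTheory GRing.Theory Num.Theory.
Import numFieldNormedType.Exports.
Local Open Scope classical_set_scope.
Local Open Scope ring_scope.

(** A neighbourhood of [M] contains a product of neighbourhoods [P i j] of its entries, and a filter
    is closed under finite intersections. *)
Lemma cvg_mx (T : topologicalType) (m n : nat) (I : Type) (F : set_system I)
    (FF : Filter F) (f : I -> 'M[T]_(m, n)) (M : 'M[T]_(m, n)) :
  (forall i j, f a i j @[a --> F] --> M i j) -> f a @[a --> F] --> M.
Proof.
move=> fM A [P MP sPA].
apply: (filterS (P := fun a => forall i j, P i j (f a i j))).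
  by move=> a Pa; exact: sPA.
by apply: filter_forall => i; apply: filter_forall => j; exact: fM.
Qed.

(* The point is that [k], [i], [j] do not depend on [B]. *)
Lemma mxdiag_entry (V : nmodType) (p : nat) (p_ : 'I_p -> nat)
    (s t : 'I_(\sum_k p_ k)) :
  (exists k i j, forall B : forall k, 'M[V]_(p_ k),
     (\mxdiag_k B k) s t = B k i j) \/
  (forall B : forall k, 'M[V]_(p_ k), (\mxdiag_k B k) s t = 0).
Proof.
have entry k1 k2 (i1 : 'I_(p_ k1)) (i2 : 'I_(p_ k2)) :
    let block := fun B : (forall k, 'M[V]_(p_ k)) =>
      (if k1 == k2 then conform_mx 0 (B k1) else 0 : 'M[V]_(p_ k1, p_ k2)) in
    (exists k i j, forall B, block B i1 i2 = B k i j) \/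
    (forall B, block B i1 i2 = 0).
  (* The type of [i2] depends on [k2], so [i2] is generalised before the two labels are
     identified. *)
  case: (eqVneq k1 k2) i2 => [<-|_] i2; last by right=> B; rewrite mxE.
  by left; exists k1, i1, i2 => B; rewrite conform_mx_id.
have [[k [i [j Bij]]]|B0] := entry _ _ (tagnat.sig2 s) (tagnat.sig2 t).
  by left; exists k, i, j => B; rewrite mxE Bij.
by right=> B; rewrite mxE B0.
Qed.

Lemma mxdiag_scale (R : pzSemiRingType) (p : nat) (p_ : 'I_p -> nat) (a : R)
    (B : forall k, 'M[R]_(p_ k)) :
  a *: \mxdiag_k B k = \mxdiag_k (a *: B k).
Proof.
apply/matrixP => s t; rewrite [LHS]mxE.
have [[k [i [j Cst]]]|Cst] := mxdiag_entry R s t; rewrite !Cst.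
  by rewrite mxE.
by rewrite mulr0.
Qed.

Lemma mxdiagX (R : pzRingType) (p : nat) (p_ : 'I_p -> nat)
    (B : forall k, 'M[R]_(p_ k)) (n : nat) :
  (\mxdiag_k B k) ^+ n = \mxdiag_k (B k ^+ n).
Proof.
elim: n => [|n IH]; first exact/esym/mxdiagZ.
rewrite exprS IH -[LHS]/(_ *m _) {2}/mxdiag mul_mxdiag_mxblock.
apply/eq_mxblock => i j; case: eqVneq => [<-|_]; last by rewrite mulmx0.
by rewrite !conform_mx_id exprS.
Qed.

Lemma cvg_mxdiag (T : Type) (F : set_system T) (FF : Filter F) (R : realType)
    (p : nat) (p_ : 'I_p -> nat)
    (f : T -> forall k, 'M[R]_(p_ k)) (B : forall k, 'M[R]_(p_ k)) :
  (forall k, f a k @[a --> F] --> B k) ->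
  \mxdiag_k (f a k) @[a --> F] --> \mxdiag_k B k.
Proof.
move=> fB; apply: cvg_mx => s t.
have [[k [i [j Cst]]]|Cst] := mxdiag_entry R s t; rewrite Cst.
  rewrite (_ : (fun a => _) = (fun a => f a k i j)); last exact/funext.
  exact: (continuous_cvg _ (@coord_continuous R _ _ i j (B k)) (fB k)).
rewrite (_ : (fun a => _) = fun=> 0); last exact/funext.
exact: cvg_cst.
Qed.

(** [expmx] is a [lim], which is informative only under convergence; naming the partial sums lets
    convergence be stated and proved first. *)
Definition expmx_series (R : realType) (n : nat) (M : 'M[R]_n) :
    nat -> 'M[R]_n :=
  series (fun j => (j`!%:R)^-1 *: M ^+ j).

Lemma expmx_eq (R : realType) (n : nat) (M E : 'M[R]_n) :
  expmx_series M @ \oo --> E -> expmx M = E.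
Proof. by move=> ME; apply: cvg_lim => //; exact: norm_hausdorff. Qed.

Lemma expmx_series_mxdiag (R : realType) (p : nat) (p_ : 'I_p -> nat)
    (B : forall k, 'M[R]_(p_ k)) (N : nat) :
  expmx_series (\mxdiag_k B k) N = \mxdiag_k (expmx_series (B k) N).
Proof.
rewrite /expmx_series /series /=; under [RHS]eq_mxdiag do rewrite big_mkord.
rewrite mxdiag_sum big_mkord; apply: eq_bigr => j _.
by rewrite mxdiagX mxdiag_scale.
Qed.

Lemma cvg_expmx_series_mxdiag (R : realType) (p : nat) (p_ : 'I_p -> nat)
    (B E : forall k, 'M[R]_(p_ k)) :
  (forall k, expmx_series (B k) @ \oo --> E k) ->
  expmx_series (\mxdiag_k B k) @ \oo --> \mxdiag_k E k.
Proof.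
move=> BE; rewrite (funext (expmx_series_mxdiag B)).
exact: cvg_mxdiag.
Qed.

(** Row [i] of [Ablock n a] meets only rows [i] and [i.+1] of the previous power, and Pascal's rule
    adds the two contributions. If [j < l - i], the exponent truncates to 0 but the binomial
    vanishes. *)
Lemma AblockX (R : realType) (n : nat) (a : R) (j : nat) (i l : 'I_n.+1) :
  (Ablock n a ^+ j) i l =
  if (i <= l)%N then 'C(j, l - i)%:R * (- a) ^+ (j - (l - i)) else 0.
Proof.
elim: j i => [|j IH] i.
  rewrite expr0 mxE bin0n -(inj_eq val_inj) /= subn_eq0 expr0 mulr1.
  by case: ltngtP.
rewrite exprS -[LHS]/((_ *m _) i l) mxE (bigD1 i)//= mxE eqxx.
have [li|il] := leqP l i.
  (* The superdiagonal entry selects row [i.+1 > l] of the power, which is 0 in column [l]. *)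
  rewrite big1 => [|m mi]; last first.
    rewrite mxE (negbTE mi); case: eqP => [e|]; last by rewrite mul0r.
    by rewrite IH e leqNgt ltnS li mulr0.
  rewrite addr0 IH; case: ltngtP li => //= [_|<-] _; first by rewrite mulr0.
  by rewrite subnn !bin0 !subn0 !mul1r exprS.
have i1 : (i.+1 < n.+1)%N by apply: leq_ltn_trans (ltn_ord l).
rewrite (bigD1 (Ordinal i1)) /=; last by rewrite -(inj_eq val_inj) /= gtn_eqF.
rewrite big1 => [|m /andP[mi mi1]]; last first.
  by rewrite mxE (negbTE mi) ifN ?mul0r.
rewrite addr0 mxE -(inj_eq val_inj) /= gtn_eqF // eqxx mul1r !IH /= il (ltnW il).
rewrite -(subnSK il); set d := (l - i.+1)%N.
rewrite binS natrD mulrDl subSS; congr (_ + _).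
(* Only for [d < j] does the extra factor [- a] raise the exponent [j - d.+1] to [j - d]; otherwise
   ['C(j, d.+1)] is 0. *)
have [dj|jd] := ltnP d j; last by rewrite bin_small // !mul0r mulr0.
by rewrite mulrCA -exprS subnSK.
Qed.

Lemma cvg_expmx_series_Ablock (R : realType) (n : nat) (a t : R) :
  expmx_series (t *: Ablock n a) @ \oo -->
  (\matrix_(i, l) (if (i <= l)%N then
     expR (- a * t) * (t ^+ (l - i) / (l - i)`!%:R) else 0) : 'M[R]_n.+1).
Proof.
apply: cvg_mx => i l; rewrite mxE.
have entry N : expmx_series (t *: Ablock n a) N i l =
    series (fun j => if (i <= l)%N then
      (j`!%:R)^-1 * (t ^+ j * ('C(j, l - i)%:R * (- a) ^+ (j - (l - i))))
      else 0) N.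
  rewrite /expmx_series /series /= summxE; apply: eq_bigr => j _.
  by rewrite mxE exprZn mxE AblockX; case: ifP => // _; rewrite !mulr0.
rewrite (funext entry); case: leqP => _; last first.
  rewrite (_ : series _ = fun=> 0); first exact: cvg_cst.
  by apply/funext => N; rewrite /series /= big1.
(* The first [d] terms vanish; the others are those of an exponential series. *)
set d := (l - i)%N; rewrite -(cvg_shiftn d).
rewrite (_ : [sequence _]_n =
             fun N => series (exp_coeff (- a * t)) N * (t ^+ d / d`!%:R)).
  by apply: cvgM; [exact: is_cvg_series_exp_coeff|exact: cvg_cst].
apply/funext => N; rewrite /series /= mulr_suml.
rewrite (big_cat_nat (n := d)) ?leq_addl //= big_nat big1 ?add0r; last first.
  by move=> j /= jd; rewrite bin_small // mul0r !mulr0.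
rewrite -{1}(add0n d) big_addn addnK; apply: eq_bigr => j _.
rewrite addnK /exp_coeff /= exprMn exprD.
have fact_neq0 m : m`!%:R != 0 :> R by rewrite pnatr_eq0 -lt0n fact_gt0.
(* Replacing [(j + d)!] by ['C(j + d, d) * (d! * j!)] cancels the binomial and separates the two
   factorials. *)
have /(congr1 (fun m => m%:R : R)) := bin_fact (leq_addl j d).
rewrite addnK !natrM => <-.
have := bin_gt0 (j + d) d; rewrite leq_addl => C0.
by field; rewrite !fact_neq0 pnatr_eq0 -lt0n C0.
Qed.

Lemma trajE (R : realType) (eta : 'I_2 -> nat) (nu : 'I_2 -> R)
    (x : 'cV[R]_(\sum_(i < 2) (eta i).+1)) (k : 'I_2) (t : R) :
  traj nu x k t =
  expR (- nu k * t) * \sum_(m < (eta k).+1) bcoord x k m * (t ^+ m / m`!%:R).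
Proof.
rewrite /traj /bcoord /Amx mxdiag_scale.
rewrite (expmx_eq (cvg_expmx_series_mxdiag
  (fun i => @cvg_expmx_series_Ablock R (eta i) (nu i) t))).
rewrite -{1}(submxcolK x) mul_mxdiag_mxcol mxcolK mxE mulr_sumr.
(* Coordinate 0 reads the top row of the block, where [l - i] is just [m]. *)
apply: eq_bigr => m _; rewrite inord_val mxE inordK // leq0n subn0.
by rewrite -mulrA (mulrC (_ / _)).
Qed.

Lemma is_derive_exp_monomial (R : realType) (m : nat) (t : R) :
  is_derive t (1 : R) (fun s : R => s ^+ m.+1 / m.+1`!%:R) (t ^+ m / m`!%:R).
Proof.
rewrite (_ : (fun _ => _) = (m.+1`!%:R)^-1 \*: (@id R ^+ m.+1)); last first.
  by apply/funext => s; rewrite /= fctE mulrC.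
apply: is_derive_eq; rewrite /GRing.scale /= mulr1 factS natrM.
have : m`!%:R != 0 :> R by rewrite pnatr_eq0 -lt0n fact_gt0.
by move=> m0; field; rewrite m0 ?natr1 ?nat1r pnatr_eq0.
Qed.

Lemma is_derive_exp_sum (R : realType) (n : nat) (c : nat -> R) (t : R) :
  is_derive t (1 : R) (fun s => \sum_(m < n.+1) c m * (s ^+ m / m`!%:R))
    (\sum_(m < n) c m.+1 * (t ^+ m / m`!%:R)).
Proof.
(* The constant term is split off; each remaining monomial drops one degree, which shifts the
   coefficients by one. *)
rewrite (_ : (fun s => _) =
    cst (c 0%N) + \sum_(m < n) c m.+1 \*: (fun s : R => s ^+ m.+1 / m.+1`!%:R)).
  rewrite -[X in is_derive _ _ _ X]add0r.
  apply: is_deriveD; apply: is_derive_sum => m.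
  by apply: is_deriveZ; exact: is_derive_exp_monomial.
apply/funext => s; rewrite big_ord_recl fctE fct_sumE; congr (_ + _).
by rewrite expr0 fact0 divr1 mulr1.
Qed.

Lemma is_derive_traj (R : realType) (eta : 'I_2 -> nat) (nu : 'I_2 -> R)
    (x : 'cV[R]_(\sum_(i < 2) (eta i).+1)) (k : 'I_2) (t : R) :
  is_derive t (1 : R) (traj nu x k) (expR (- nu k * t) * crit_lhs nu x k t).
Proof.
have dS := is_derive_exp_sum (eta k) (bcoord x k) t.
have dE : is_derive t (1 : R) (expR \o (- nu k \*: @id R))
    (expR (- nu k * t) * - nu k).
  apply: is_derive1_comp; apply: is_derive_eq.
  by rewrite /GRing.scale /= mulr1.
have := is_deriveM dE dS; rewrite (_ : _ * _ = traj nu x k); last first.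
  by apply/funext => s; rewrite trajE.
move=> dT; apply: is_derive_eq; rewrite /GRing.scale /= /crit_lhs.
(* The undifferentiated sum has one more term than its derivative; this top term is the isolated
   last term of [crit_lhs]. *)
rewrite big_ord_recr /=.
under [in RHS]eq_bigr do rewrite mulrDl -mulrA.
rewrite big_split /= -mulr_sumr; ring.
Qed.

Lemma is_max_sup (R : realType) (S : set R) (v : R) :
  is_max S v -> sup S = v.
Proof.
move=> [Sv ubv]; apply/eqP; rewrite eq_le ge_sup //=; last by exists v.
by apply: ub_le_sup => //; exists v.
Qed.

Theorem lemma4 (R : realType) (eta : 'I_2 -> nat) (nu : 'I_2 -> R)
    (heta : forall k, (1 <= eta k)%N) (hnu : forall k, 0 < nu k)
    (Delta : R) (hDelta : 0 < Delta)
    (k : 'I_2) (x : 'cV[R]_(\sum_(i < 2) (eta i).+1)) :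
  [/\ has_sup (traj_values nu Delta k x),
      is_max ([set bcoord x k 0]
              `|` [set traj nu x k t | t in
                     critical_points (traj nu x k) Delta]
              `|` [set traj nu x k Delta])
        (Phi nu Delta k x)
    & critical_points (traj nu x k) Delta
      = [set t | 0 < t < Delta /\ crit_lhs nu x k t = 0]].
Proof.
have der t := is_derive_traj nu x k t.
have traj0 : traj nu x k 0 = bcoord x k 0.
  rewrite trajE mulr0 expR0 mul1r big_ord_recl expr0 divr1 mulr1.
  by rewrite big1 ?addr0 // => m _; rewrite expr0n mul0r mulr0.
have cont : {within `[0, Delta], continuous traj nu x k}.
  by apply: derivable_within_continuous => t _.
have [c cD cmax] := EVT_max (ltW hDelta) cont.
have Tmax : is_max (traj_values nu Delta k x) (traj nu x k c).
  split; first by exists c; rewrite // in_itv in cD.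
  by move=> _ [t tD <-]; apply: cmax; rewrite in_itv.
rewrite /Phi (is_max_sup Tmax); split.
- by split; exists (traj nu x k c); case: Tmax.
- split; last first.
    have [_ ub] := Tmax.
    move=> _ [[->|[t [/andP[t0 tD] _] <-]]|->]; apply: ub.
    + by exists 0; rewrite ?traj0 //= lexx ltW.
    + by exists t; rewrite //= !ltW.
    + by exists Delta; rewrite //= lexx ltW.
  (* The maximiser [c] is 0, [Delta] or an interior point; in the last case Fermat's theorem makes
     it critical. *)
  move: cD; rewrite in_itv /= !le_eqVlt => /andP[/predU1P[<-|c0]].
    by rewrite traj0; left; left.
  move=> /predU1P[->|cD]; first by right.
  left; right; exists c => //; split; first by rewrite c0.
  apply: (derive1_at_max (ltW hDelta)).
  + by move=> t _.
  + by rewrite in_itv /= c0.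
  + move=> t; rewrite in_itv /= => /andP[t0 tD]; apply: cmax.
    by rewrite in_itv /= !ltW.
- apply/seteqP; split => t [tD].
    (* The derivative has a single value, so 0 equals the exponential times [crit_lhs], and the
       exponential is positive. *)
    move=> d0; split=> //; have := @derive_val _ _ _ _ _ _ _ d0.
    by rewrite (@derive_val _ _ _ _ _ _ _ (der t)) => /eqP;
      rewrite mulf_eq0 gt_eqF ?expR_gt0 //= => /eqP.
  by move=> crit0; split=> //; apply: is_derive_eq; rewrite crit0 mulr0.
Qed.
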